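(* Let $P$ be the uniform distribution on $[0,1]$ and let $\beta=\{\frac14,\frac12\}$. For $n\in\mathbb{N}$ with $n\geq 6$, let $\alpha_n$ be a conditional optimal set of $n$-points for $P$ with respect to $\beta$, and let $k=\mathrm{card}(\alpha_n\cap[0,\frac14])$, $\ell=\mathrm{card}(\alpha_n\cap[\frac14,\frac12])$, $m=\mathrm{card}(\alpha_n\cap[\frac12,1])$. For $x\in\mathbb{N}$: if $n=4x+2$ then $(k,\ell,m)=(x+1,x+2,2x+1)$; if $n=4x+3$ then $(k,\ell,m)=(x+1,x+2,2x+2)$; if $n=4x+4$ then $(k,\ell,m)=(x+2,x+2,2x+2)$; if $n=4x+5$ then $(k,\ell,m)=(x+2,x+2,2x+3)$.
   Context: Conditional quantization on $\mathbb{R}$: for a Borel probability measure $P$ on $\mathbb{R}$ and a finite set $\beta\subset\mathbb{R}$ with $\mathrm{card}(\beta)=r$, for $n\geq r$ the $n$th conditional quantization error is $V_n=\inf\{\int\min_{a\in\alpha\cup\beta}(x-a)^2\,dP(x):\alpha\subset\mathbb{R},\ \mathrm{card}(\alpha)\leq n-r\}$. A set $\alpha\cup\beta$ attaining this infimum, such that $P(M(b\mid\alpha\cup\beta))>0$ for every $b\in\beta$ (where $M(b\mid\Gamma)=\{x:|x-b|=\min_{c\in\Gamma}|x-c|\}$ is the Voronoi region of $b$), is called a conditional optimal set of $n$-points for $P$ with respect to $\beta$; it contains $\beta$. *)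

(* Defs.v *)
From HB Require Import structures.
From mathcomp Require Import all_boot all_order all_algebra finmap.
From mathcomp Require Import all_classical all_reals all_analysis.
From mathcomp Require Import uniform_distribution.
Set Implicit Arguments. Unset Strict Implicit. Unset Printing Implicit Defensive.
Import Order.TTheory GRing.Theory Num.Theory.
Local Open Scope ring_scope.
Local Open Scope fset_scope.

Definition unifP (R : realType) := uniform_prob (@ltr01 R).
Arguments unifP : clear implicits.

Definition fmin (R : realType) (G : {fset R}) (f : R -> R) : \bar R :=
  \big[Order.min/+oo%E]_(a <- G) (f a)%:E.

Definition voronoi (R : realType) (b : R) (G : {fset R}) : set R :=
  [set x | (`|x - b|)%:E = fmin G (fun c => `|x - c|)].

Definition distortion (R : realType) (G : {fset R}) : \bar R :=
  (\int[unifP R]_x fmin G (fun a : R => (((x : R) - a) ^+ 2)%R))%E.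

Definition cond_optimal (R : realType) (n : nat) (beta G : {fset R}) : Prop :=
  [/\ (#|` beta| <= n)%N,
      (exists alpha : {fset R}, (#|` alpha| <= n - #|` beta|)%N /\ G = alpha `|` beta),
      (forall alpha : {fset R}, (#|` alpha| <= n - #|` beta|)%N ->
          (distortion G <= distortion (alpha `|` beta))%E) &
      (forall b, b \in beta -> (0 < unifP R (voronoi b G))%E)].

Definition count_in (R : realType) (G : {fset R}) (a b : R) : nat :=
  #|` [fset x in G | (a <= x <= b)] |.

(* Main.v *)
(* On an interval of length [L], a point inside owns two half cells and a point
   at or beyond an end owns one.
   With [j] half cells in all, the integral of the squared distance over the
   interval is at least [L^3 / (3 j^2)], with equality for the equispaced grid.
   The intervals [0, 1/4], [1/4, 1/2], [1/2, 1] are decoupled by the two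
   prescribed points, so with [a], [b], [c] free points in them 192 times the
   distortion is at best [1/(2a+1)^2 + 1/(2b+2)^2 + 8/(2c+1)^2], where
   [a + b + c = n - 2]. Each summand is convex, so the minimum is found greedily,
   and it is unique because the gains of the successive points form a strictly
   decreasing chain. Points outside the open unit interval own a single half
   cell, hence are never optimal. *)

Require Import Defs.
From HB Require Import structures.
From mathcomp Require Import all_boot all_order all_algebra finmap.
From mathcomp Require Import all_classical all_reals all_analysis.
From mathcomp Require Import measurable_realfun uniform_distribution.
From mathcomp Require Import ring lra zify.
Set Implicit Arguments. Unset Strict Implicit. Unset Printing Implicit Defensive.
Import Order.TTheory GRing.Theory Num.Theory.
Import numFieldNormedType.Exports.
Local Open Scope ring_scope.
Local Open Scope classical_set_scope.

(** * Integrals of quadratic polynomials over an interval *)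

Local Notation mu := lebesgue_measure.

(** A single antiderivative serves the three integrands met below: the constant [h ^+ 2], the
    parabola [h ^+ 2 - (x - a) ^+ 2] and the squared distance to one point. *)
Lemma integral_quad (R : realType) (A B p c d : R) : c <= d ->
  (\int[mu]_(x in `[c, d]) (A + B * (x - p) ^+ 2)%:E =
   (A * (d - c) + B / 3 * ((d - p) ^+ 3 - (c - p) ^+ 3))%:E)%E.
Proof.
rewrite le_eqVlt => /predU1P[<-|cd].
  by rewrite set_itv1 integral_set1; congr (_%:E); ring.
pose F (x : R) := A * x + B / 3 * (x - p) ^+ 3.
have dF (x : R) : is_derive x 1 F (A + B * (x - p) ^+ 2).
  rewrite /F; apply: is_derive_eq.
  by rewrite /GRing.scale /=; field.
have cF (x : R) : {for x, continuous F}.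
  by apply/differentiable_continuous/derivable1_diffP; exact: ex_derive.
rewrite (continuous_FTC2 (F := F) cd).
- by rewrite -EFinB /F; congr (_%:E); ring.
- apply: continuous_subspaceT => x.
  by apply/differentiable_continuous/derivable1_diffP; exact: ex_derive.
- split.
  + by move=> x _; exact: ex_derive.
  + exact/cvg_at_right_filter/cF.
  + exact/cvg_at_left_filter/cF.
- by move=> x _; rewrite derive1E; exact: derive_val.
Qed.

(** * The squared distance to a finite set *)

Section fmin.
Variables (R : realType) (G : {fset R}).
Let d (x : R) : \bar R := fmin G (fun a => (x - a) ^+ 2).

Lemma fmin_sqr_le (x a : R) : a \in G -> (d x <= ((x - a) ^+ 2)%:E)%E.
Proof. by move=> aG; rewrite /d /fmin; apply: ge_bigmin_seq. Qed.

Lemma le_fmin_sqr (x r : R) :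
  (forall a, a \in G -> r <= (x - a) ^+ 2) -> (r%:E <= d x)%E.
Proof.
move=> H; rewrite /d /fmin big_seq; apply: le_bigmin; first exact: leey.
by move=> a aG; rewrite lee_fin H.
Qed.

Lemma fmin_sqr_ge0 (x : R) : (0 <= d x)%E.
Proof. by apply: le_fmin_sqr => a _; rewrite sqr_ge0. Qed.

Lemma measurable_sqr_sub (D : set R) (a : R) :
  measurable_fun D (fun x : R => ((x - a) ^+ 2 : R)%:E).
Proof.
apply/measurable_EFinP; apply: measurable_funX.
by apply: measurable_funB => //.
Qed.

Lemma measurable_fmin_sqr (D : set R) : measurable_fun D d.
Proof.
rewrite /d /fmin; elim: (enum_fset G) => [|a s IH].
  by under eq_fun do rewrite big_nil; exact: measurable_cst.
under eq_fun do rewrite big_cons.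
by apply: measurable_mine => //; exact: measurable_sqr_sub.
Qed.

End fmin.

(** * Lower and upper bounds for the integral of the squared distance over an interval *)

Section integration.
Variable R : realType.
Implicit Types (s t a h : R) (f : R -> \bar R).

Lemma ge0_integral_itv_split s a t f : s <= a <= t ->
  measurable_fun setT f -> (forall x, (0 <= f x)%E) ->
  (\int[mu]_(x in `[s, t]) f x =
   \int[mu]_(x in `[s, a]) f x + \int[mu]_(x in `[a, t]) f x)%E.
Proof.
move=> /andP[sa at_] mf f0.
have -> : `[s, t] = `[s, a] `|` `]a, t] :> set R.
  by rewrite -itv_bndbnd_setU// bnd_simp.
rewrite ge0_integral_setU//.
- by rewrite -(integral_itv_obnd_cbnd (r := a))//; exact: measurable_funTS.
- exact: measurable_funTS.
- rewrite disj_set2E; apply/eqP/seteqP; split => // x [] /=.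
  by rewrite !in_itv/= => /andP[_ xa] /andP[ax _]; rewrite ltNge xa in ax.
Qed.

(** For [0 <= h] this is the positive part of the parabola, written as a restriction so that its
    integral becomes that of a polynomial over a smaller interval. *)
Definition bump h a : R -> \bar R :=
  (fun x => (h ^+ 2 - (x - a) ^+ 2)%:E) \_ `[a - h, a + h].

Lemma measurable_parabola h a (D : set R) :
  measurable_fun D (fun x : R => (h ^+ 2 - (x - a) ^+ 2 : R)%:E).
Proof.
apply/measurable_EFinP; apply: measurable_funB => //.
by apply: measurable_funX; apply: measurable_funB.
Qed.

Lemma parabola_ge0 h a x : 0 <= h -> `[a - h, a + h]%classic x ->
  0 <= h ^+ 2 - (x - a) ^+ 2.
Proof. by move=> h0; rewrite /= in_itv/= => /andP[? ?]; nra. Qed.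

Lemma bump_ge0 h a x : 0 <= h -> (0 <= bump h a x)%E.
Proof.
move=> h0; rewrite /bump patchE; case: ifPn => //; rewrite inE => xa.
by rewrite lee_fin parabola_ge0.
Qed.

Lemma bump_ge h a x : 0 <= h -> ((h ^+ 2 - (x - a) ^+ 2)%:E <= bump h a x)%E.
Proof.
move=> h0; rewrite /bump patchE; case: ifPn => //.
rewrite notin_setE/= in_itv/= => /negP; rewrite negb_and -!ltNge lee_fin.
by case/orP => ?; nra.
Qed.

Lemma measurable_bump h a (D : set R) : measurable_fun D (bump h a).
Proof.
apply: measurable_funTS; apply/(measurable_restrictT _ _).1 => //.
exact: measurable_parabola.
Qed.

(** Each half of a bump has integral [2 / 3 * h ^+ 3], and a centre outside []s, t[] leaves at most
    one half over [[s, t]]; the factor thus counts half cells. *)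
Lemma integral_bump_le s t a h : 0 <= h ->
  (\int[mu]_(x in `[s, t]) bump h a x
     <= ((1 + (s < a < t)%R)%N%:R * (2 / 3 * h ^+ 3))%:E)%E.
Proof.
move=> h0.
(* Here [[lo, hi]] is a piece of the support covering its part in [[s, t]]; the cases below take the
   whole support or one half. *)
have sub lo hi : lo <= hi -> a - h <= lo -> hi <= a + h ->
    (forall x, s <= x <= t -> a - h <= x <= a + h -> lo <= x <= hi) ->
    (\int[mu]_(x in `[s, t]) bump h a x <=
     (h ^+ 2 * (hi - lo) - 1 / 3 * ((hi - a) ^+ 3 - (lo - a) ^+ 3))%:E)%E.
  move=> lohi alo hia H.
  have := integral_quad (h ^+ 2) (- 1) a lohi.
  under eq_integral do rewrite mulN1r.
  rewrite !mulNr => <-.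
  rewrite /bump -integral_mkcondr; apply: ge0_subset_integral.
  - exact: measurableI.
  - by [].
  - exact: measurable_parabola.
  - move=> x /=; rewrite in_itv/= => /andP[lox xhi].
    by rewrite lee_fin (@parabola_ge0 h a x)//= in_itv/=; lra.
  - by move=> x [] /=; rewrite !in_itv/=; exact: H.
have [_|/nandP[]] := boolP (s < a < t).
- rewrite -[(1 + true)%N]/2%N.
  apply: (le_trans (sub (a - h) (a + h) _ _ _ _)) => //; first lra.
  by rewrite lee_fin; lra.
- rewrite -leNgt -[(1 + false)%N]/1%N => as_.
  apply: (le_trans (sub a (a + h) _ _ _ _)) => //; [lra|lra|move=> x; lra|].
  by rewrite lee_fin; lra.
- rewrite -leNgt -[(1 + false)%N]/1%N => ta.
  apply: (le_trans (sub (a - h) a _ _ _ _)) => //; [lra|lra|move=> x; lra|].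
  by rewrite lee_fin; lra.
Qed.

(* Pointwise, [h^2] is at most the squared distance plus the sum of the bumps of
   radius [h] around the points of [F]; the choice [h = (t - s) / j] is optimal. *)
Lemma integral_fmin_ge s t (G : {fset R}) (F : seq R) :
  let j := (size F + count (fun a => s < a < t)%R F)%N in
  s <= t -> (0 < j)%N ->
  (forall x p, s <= x <= t -> p \in G ->
     exists2 a, a \in F & (x - a) ^+ 2 <= (x - p) ^+ 2) ->
  (((t - s) ^+ 3 / (3 * j%:R ^+ 2))%:E <=
   \int[mu]_(x in `[s, t]) fmin G (fun a => ((x : R) - a) ^+ 2)%R)%E.
Proof.
move=> j st j0 near.
have j0R : 0 < j%:R :> R by rewrite ltr0n.
pose h := (t - s) / j%:R.
have h0 : 0 <= h by rewrite /h divr_ge0// subr_ge0.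
have b0 x a : (0 <= bump h a x)%E by exact: bump_ge0.
have jE : (j%:R * (2 / 3 * h ^+ 3) =
    \sum_(a <- F) (1 + (s < a < t)%R)%N%:R * (2 / 3 * h ^+ 3))%R.
  rewrite -big_distrl/= -natr_sum; congr (_%:R * _).
  by rewrite big_split/= sum1_size -big_mkcond/= sum1_count.
have int_h2 : (\int[mu]_(x in `[s, t]) (h ^+ 2)%:E = (h ^+ 2 * (t - s))%:E)%E.
  have := integral_quad (h ^+ 2) 0 0 st.
  by under eq_integral do rewrite mul0r addr0; rewrite !mul0r addr0.
have : (\int[mu]_(x in `[s, t]) (h ^+ 2)%:E <=
    \int[mu]_(x in `[s, t]) (fmin G (fun a => ((x : R) - a) ^+ 2)%R +
      \sum_(a <- F) bump h a x))%E.
  apply: ge0_le_integral => //=.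
  - by move=> x _; rewrite lee_fin sqr_ge0.
  - apply: emeasurable_funD; first exact: measurable_fmin_sqr.
    by apply: emeasurable_sum => a; exact: measurable_bump.
  - move=> x; rewrite /= in_itv/= => xst.
    have Sfin : (\sum_(a <- F) bump h a x)%E \is a fin_num.
      rewrite sum_fin_num; apply/allP => _ /mapP[a _ ->].
      by rewrite /bump patchE; case: ifP.
    rewrite -leeBlDr// -(fineK Sfin) -EFinB.
    (* One bump suffices: the point of [F] at least as near as [p] contributes at least
       [h ^+ 2 - (x - p) ^+ 2], and the other bumps are nonnegative. *)
    apply: le_fmin_sqr => p pG; have [a aF /(le_trans _)] := near _ _ xst pG.
    apply; rewrite lerBlDr -lerBlDl -lee_fin fineK//.
    apply: (le_trans (bump_ge a x h0)).
    by rewrite (big_rem a)//= leeDl// sume_ge0.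
rewrite int_h2 ge0_integralD//=; last 4 first.
- by move=> x _; exact: fmin_sqr_ge0.
- exact: measurable_fmin_sqr.
- by move=> x _; apply: sume_ge0.
- by apply: emeasurable_sum => a; exact: measurable_bump.
rewrite ge0_integral_sum//=; last first.
- by move=> a; exact: measurable_bump.
move=> /le_trans /(_ (leeD2l _ (lee_sum _ (fun a _ => @integral_bump_le s t a h h0)))).
rewrite sumEFin -jE -leeBlDr// -EFinB; apply: le_trans.
(* For [h = (t - s) / j], the difference [h^2 (t - s) - (2/3) j h^3] equals
   [(t - s)^3 / (3 j^2)]. *)
rewrite lee_fin /h le_eqVlt; apply/orP; left; apply/eqP.
by field; rewrite gt_eqF.
Qed.

(** Over a half cell of width [h] with one end in [G], the squared distance to that end integrates
    to [h ^+ 3 / 3]; induction adds up the [N] half cells. *)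
Lemma integral_fmin_le s h N (G : {fset R}) : 0 <= h ->
  (forall i, (i < N)%N -> s + i%:R * h \in G \/ s + i.+1%:R * h \in G) ->
  (\int[mu]_(x in `[s, (s + N%:R * h)%R]) fmin G (fun a => ((x : R) - a) ^+ 2)%R
   <= (N%:R * (h ^+ 3 / 3))%:E)%E.
Proof.
move=> h0; elim: N => [_|N IH grid].
  by rewrite !mul0r addr0 set_itv1 integral_set1.
rewrite (@ge0_integral_itv_split _ (s + N%:R * h)); last 3 first.
- rewrite lerDl mulr_ge0//= lerD2l ler_wpM2r//.
  by rewrite ler_nat.
- exact: measurable_fmin_sqr.
- by move=> x; exact: fmin_sqr_ge0.
rewrite -natr1 [in leRHS]mulrDl mul1r EFinD.
apply: leeD; first by apply: IH => i iN; apply: grid; exact: leqW.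
have cell : s + N%:R * h <= s + (N%:R + 1) * h by rewrite lerD2l ler_wpM2r// lerDl.
have sqr_int p : p \in G ->
  (\int[mu]_(x in `[(s + N%:R * h)%R, (s + (N%:R + 1) * h)%R])
    fmin G (fun a => ((x : R) - a) ^+ 2)%R <=
   (1 / 3 * ((s + (N%:R + 1) * h - p) ^+ 3 - (s + N%:R * h - p) ^+ 3))%:E)%E.
  move=> pG; have := integral_quad 0 1 p cell.
  under eq_integral do rewrite add0r mul1r.
  rewrite mul0r add0r => <-.
  apply: ge0_le_integral => //=.
  - by move=> x _; exact: fmin_sqr_ge0.
  - exact: measurable_fmin_sqr.
  - exact: measurable_sqr_sub.
  - by move=> x _; exact: fmin_sqr_le.
have [/sqr_int|] := grid N (ltnSn N); last rewrite -natr1 => /sqr_int.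
all: move=> /le_trans; apply; rewrite lee_fin; lra.
Qed.

(** * The distortion of the uniform law and of equispaced grids *)

Lemma distortion_itv (G : {fset R}) :
  let I (s t : R) := (\int[mu]_(x in `[s, t]) fmin G (fun a => ((x : R) - a) ^+ 2)%R)%E in
  (distortion G = I 0%R (1 / 4)%R + I (1 / 4)%R (1 / 2)%R + I (1 / 2)%R 1%R)%E.
Proof.
move=> I; rewrite /distortion /unifP integral_uniform; last 2 first.
- exact: measurable_fmin_sqr.
- by move=> x; exact: fmin_sqr_ge0.
rewrite subr0 invr1 mul1e -!ge0_integral_itv_split//.
all: try exact: measurable_fmin_sqr.
all: try (by move=> x; exact: fmin_sqr_ge0).
all: lra.
Qed.

Local Notation beta := ([fset (1 / 4 : R); (1 / 2 : R)]%fset).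

(* The sum over [0, 1/4], [1/4, 1/2], [1/2, 1] of [L^3 / (3 j^2)], times 192. *)
Definition err (i j k : nat) : R :=
  1 / i%:R ^+ 2 + 1 / j%:R ^+ 2 + 8 / k%:R ^+ 2.

(** The ends of equal half cells alternate between points and cell boundaries. Since [1/4] and [1/2]
    are points while [0] and [1] are boundaries, the points are the odd multiples of [h1] from [0]
    and the even multiples of [h2] and [h3] from [1/4] and [1/2]. *)
Lemma distortion_grid (a b c : nat) : exists alpha : {fset R},
  (#|` alpha| <= a + b + c)%N /\
  (distortion (alpha `|` beta)%fset <=
    (1 / 192 * err (2 * a + 1) (2 * b + 2) (2 * c + 1))%:E)%E.
Proof.
pose h1 : R := 1 / 4 / (2 * a + 1)%:R.
pose h2 : R := 1 / 4 / (2 * b + 2)%:R.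
pose h3 : R := 1 / 2 / (2 * c + 1)%:R.
have ga : (2 * a + 1)%:R != 0 :> R by rewrite pnatr_eq0 addn1.
have gb : (2 * b + 2)%:R != 0 :> R by rewrite pnatr_eq0 addn2.
have gc : (2 * c + 1)%:R != 0 :> R by rewrite pnatr_eq0 addn1.
pose s := [seq 0 + (2 * i + 1)%:R * h1 | i <- iota 0 a] ++
  [seq 1 / 4 + (2 * i + 2)%:R * h2 | i <- iota 0 b] ++
  [seq 1 / 2 + (2 * i + 2)%:R * h3 | i <- iota 0 c].
exists (seq_fset tt s); split.
  rewrite size_seq_fset (leq_trans (size_undup _))//.
  by rewrite !size_cat !size_map !size_iota addnA.
have mem p : p \in s \/ p = 1 / 4 \/ p = 1 / 2 -> p \in (seq_fset tt s `|` beta)%fset.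
  rewrite !inE seq_fsetE; move=> [->//|[->|->]]; rewrite eqxx ?orbT//.
have odd1 i : odd i -> (i <= 2 * a + 1)%N ->
    0 + i%:R * h1 \in (seq_fset tt s `|` beta)%fset.
  move=> oi ia; apply: mem.
  have [iaE|ia'] := eqVneq i (2 * a + 1)%N.
    by right; left; rewrite iaE /h1; field.
  left; rewrite mem_cat; apply/orP; left; apply/mapP; exists (i./2).
    by rewrite mem_iota; lia.
  by congr (_ + _%:R * _); lia.
have even2 i : ~~ odd i -> (i <= 2 * b + 2)%N ->
    1 / 4 + i%:R * h2 \in (seq_fset tt s `|` beta)%fset.
  move=> oi ib; apply: mem.
  have [->|i0] := eqVneq i 0%N; first by right; left; rewrite mul0r addr0.
  have [iE|ib'] := eqVneq i (2 * b + 2)%N.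
    by right; right; rewrite iE /h2; field.
  left; rewrite !mem_cat; apply/orP; right; apply/orP; left.
  apply/mapP; exists (i./2.-1); first by rewrite mem_iota; lia.
  by congr (_ + _%:R * _); lia.
have even3 i : ~~ odd i -> (i <= 2 * c)%N ->
    1 / 2 + i%:R * h3 \in (seq_fset tt s `|` beta)%fset.
  move=> oi ib; apply: mem.
  have [->|i0] := eqVneq i 0%N; first by right; right; rewrite mul0r addr0.
  left; rewrite !mem_cat; apply/orP; right; apply/orP; right.
  apply/mapP; exists (i./2.-1); first by rewrite mem_iota; lia.
  by congr (_ + _%:R * _); lia.
rewrite distortion_itv.
have h10 : 0 <= h1 by rewrite /h1 divr_ge0.
have h20 : 0 <= h2 by rewrite /h2 divr_ge0.
have h30 : 0 <= h3 by rewrite /h3 divr_ge0.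
have e1 : 1 / 4 = 0 + (2 * a + 1)%:R * h1 by rewrite /h1; field.
have e2 : 1 / 2 = 1 / 4 + (2 * b + 2)%:R * h2 by rewrite /h2; field.
have e3 : 1 = 1 / 2 + (2 * c + 1)%:R * h3 by rewrite /h3; field.
apply: (@le_trans _ _ ((2 * a + 1)%:R * (h1 ^+ 3 / 3) +
  (2 * b + 2)%:R * (h2 ^+ 3 / 3) + (2 * c + 1)%:R * (h3 ^+ 3 / 3))%:E); last first.
  rewrite lee_fin le_eqVlt; apply/orP; left; apply/eqP.
  rewrite /err /h1 /h2 /h3; move: ga gb gc.
  move: (2 * a + 1)%:R (2 * b + 2)%:R (2 * c + 1)%:R => u v w u0 v0 w0.
  by field; rewrite u0 v0 w0.
rewrite !EFinD; apply: leeD; first apply: leeD.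
(* Of two consecutive indices one has the parity of a grid point. *)
- have grid i : (i < 2 * a + 1)%N ->
      0 + i%:R * h1 \in (seq_fset tt s `|` beta)%fset \/
      0 + i.+1%:R * h1 \in (seq_fset tt s `|` beta)%fset.
    by have [oi|oi] := boolP (odd i) => ?; [left|right]; apply: odd1; lia.
  by have := integral_fmin_le h10 grid; rewrite -e1.
- have grid i : (i < 2 * b + 2)%N ->
      1 / 4 + i%:R * h2 \in (seq_fset tt s `|` beta)%fset \/
      1 / 4 + i.+1%:R * h2 \in (seq_fset tt s `|` beta)%fset.
    by have [oi|oi] := boolP (odd i) => ?; [right|left]; apply: even2; lia.
  by have := integral_fmin_le h20 grid; rewrite -e2.
- have grid i : (i < 2 * c + 1)%N ->
      1 / 2 + i%:R * h3 \in (seq_fset tt s `|` beta)%fset \/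
      1 / 2 + i.+1%:R * h3 \in (seq_fset tt s `|` beta)%fset.
    by have [oi|oi] := boolP (odd i) => ?; [right|left]; apply: even3; lia.
  by have := integral_fmin_le h30 grid; rewrite -e3.
Qed.
End integration.

(** * Point counts on intervals and the resulting lower bound for the distortion *)

Section optimality.
Variable R : realType.
Implicit Types (s t : R).

Lemma count_disjoint (T : Type) (P Q S : pred T) (g : seq T) :
  (forall x, P x = Q x || S x) -> (forall x, ~~ (Q x && S x)) ->
  count P g = (count Q g + count S g)%N.
Proof.
move=> PQS QS0; elim: g => //= y g ->; rewrite PQS.
by have := QS0 y; case: (Q y); case: (S y) => //= _; lia.
Qed.

Lemma count_fset1 (G : {fset R}) q : q \in G -> count (pred1 q) G = 1%N.
Proof. by move=> qG; rewrite count_uniq_mem ?fset_uniq// qG. Qed.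

Lemma count_inE (G : {fset R}) s t :
  count_in G s t = count (fun p => s <= p <= t) G.
Proof.
rewrite /count_in -size_filter; apply/perm_size/uniq_perm => //.
  by rewrite filter_uniq ?fset_uniq.
by move=> p; rewrite !inE mem_filter andbC.
Qed.

Lemma count_le_lt (G : {fset R}) q : q \in G ->
  count (fun p => p <= q) G = (count (fun p => (p < q)%R) G).+1.
Proof.
move=> qG; rewrite -addn1 -(count_fset1 qG); apply: count_disjoint => x /=.
  by rewrite le_eqVlt orbC.
by case: ltgtP.
Qed.

Lemma count_ge_gt (G : {fset R}) q : q \in G ->
  count (fun p => q <= p) G = (count (fun p => (q < p)%R) G).+1.
Proof.
move=> qG; rewrite -addn1 -(count_fset1 qG); apply: count_disjoint => x /=.
  by rewrite le_eqVlt orbC eq_sym.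
by case: ltgtP.
Qed.

Lemma count_itvoc (G : {fset R}) s t : s < t -> t \in G ->
  count (fun p => s < p <= t) G = (count (fun p => (s < p < t)%R) G).+1.
Proof.
move=> st tG; rewrite -addn1 -(count_fset1 tG); apply: count_disjoint => x /=.
  by rewrite [x <= t]le_eqVlt; case: eqVneq => [->|_]; rewrite ?st ?orbT ?orbF.
by case: (ltgtP x t); rewrite ?andbF.
Qed.

Lemma count_itvco (G : {fset R}) s t : s < t -> s \in G ->
  count (fun p => s <= p < t) G = (count (fun p => (s < p < t)%R) G).+1.
Proof.
move=> st sG; rewrite -addn1 -(count_fset1 sG); apply: count_disjoint => x /=.
  by rewrite [s <= x]le_eqVlt eq_sym; case: eqVneq => [->|_]; rewrite ?st ?orbT ?orbF.
by case: (ltgtP s x); rewrite ?andbF.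
Qed.

Lemma count_itvcc (G : {fset R}) s t : s < t -> s \in G -> t \in G ->
  count (fun p => s <= p <= t) G = (count (fun p => (s < p < t)%R) G).+2.
Proof.
move=> st sG tG; rewrite -(count_itvco st sG) -addn1 -(count_fset1 tG).
apply: count_disjoint => x /=.
  rewrite [x <= t]le_eqVlt; case: eqVneq => [->|_]; rewrite ?(ltW st) ?orbT ?orbF//.
by case: (ltgtP x t); rewrite ?andbF.
Qed.

(** On each interval, a point beyond a prescribed end can be replaced by that end, which is at least
    as near. In [a + a' + 1], each point below [1/4] brings one half cell, those that are also
    positive bring a second, and [1/4] itself brings one; [c + c' + 1] is the mirror case. *)
Lemma distortion_ge (G : {fset R}) (a a' b c c' : nat) :
  1 / 4 \in G -> 1 / 2 \in G ->
  a = count (fun p : R => (p < 1 / 4)%R) G ->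
  a' = count (fun p : R => (0 < p < 1 / 4)%R) G ->
  b = count (fun p : R => (1 / 4 < p < 1 / 2)%R) G ->
  c = count (fun p : R => (1 / 2 < p)%R) G ->
  c' = count (fun p : R => (1 / 2 < p < 1)%R) G ->
  ((1 / 192 * err R (a + a' + 1) (2 * b + 2) (c + c' + 1))%:E
    <= distortion G)%E.
Proof.
move=> G4 G2 aE a'E bE cE c'E.
have near s t P : (forall p x, p \in G -> s <= x <= t ->
    exists2 q, (q \in G) && P q & (x - q) ^+ 2 <= (x - p) ^+ 2) ->
    forall x p, s <= x <= t -> p \in G ->
    exists2 q, q \in [seq q <- G | P q] & (x - q) ^+ 2 <= (x - p) ^+ 2.
  move=> near x p xst pG; have [q /andP[qG Pq] qp] := near p x pG xst.
  by exists q; rewrite // mem_filter Pq.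
have n1 := @near 0 (1 / 4) (fun p : R => p <= 1 / 4) _.
have n2 := @near (1 / 4) (1 / 2) (fun p : R => 1 / 4 <= p <= 1 / 2) _.
have n3 := @near (1 / 2) 1 (fun p : R => 1 / 2 <= p) _.
have p1 : count (predI (fun p : R => 0 < p < 1 / 4) (fun p => p <= 1 / 4)) G = a'.
  by rewrite a'E; apply: eq_count => p /=; apply/andb_idr => /andP[_ /ltW].
have p2 : count (predI (fun p : R => 1 / 4 < p < 1 / 2)
    (fun p => 1 / 4 <= p <= 1 / 2)) G = b.
  by rewrite bE; apply: eq_count => p /=; apply/andb_idr => /andP[/ltW -> /ltW ->].
have p3 : count (predI (fun p : R => 1 / 2 < p < 1) (fun p => 1 / 2 <= p)) G = c'.
  by rewrite c'E; apply: eq_count => p /=; apply/andb_idr => /andP[/ltW].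
have I1 := @integral_fmin_ge _ 0 (1 / 4) G _ _ _ (n1 _).
have I2 := @integral_fmin_ge _ (1 / 4) (1 / 2) G _ _ _ (n2 _).
have I3 := @integral_fmin_ge _ (1 / 2) 1 G _ _ _ (n3 _).
have lt42 : 1 / 4 < 1 / 2 :> R by lra.
rewrite size_filter count_filter p1 count_le_lt// -aE in I1.
rewrite size_filter count_filter p2 count_itvcc// -bE in I2.
rewrite size_filter count_filter p3 count_ge_gt// -cE in I3.
rewrite distortion_itv; pose I (s t : R) : \bar R :=
  (\int[mu]_(x in `[s, t]) fmin G (fun p => ((x : R) - p) ^+ 2)%R)%E.
have {}I1 : (((1 / 4 - 0) ^+ 3 / (3 * (a.+1 + a')%:R ^+ 2))%:E <= I 0%R (1 / 4)%R)%E.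
  apply: I1 => //.
  move=> p x pG xst; have [p4|p4] := leP p (1 / 4).
    by exists p; rewrite ?pG ?p4.
  by exists (1 / 4); rewrite ?G4 ?lexx//; nra.
have {}I2 : (((1 / 2 - 1 / 4) ^+ 3 / (3 * (b.+2 + b)%:R ^+ 2))%:E <= I (1 / 4)%R (1 / 2)%R)%E.
  apply: I2 => //; first exact: ltW.
  move=> p x pG xst; have [p4|p4] := ltP p (1 / 4).
    by exists (1 / 4); rewrite ?G4 ?lexx//=; [lra|nra].
  have [lt2p|p2_] := ltP (1 / 2) p.
    by exists (1 / 2); rewrite ?G2 ?lexx//=; [lra|nra].
  by exists p; rewrite ?pG ?p2_ ?p4.
have {}I3 : (((1 - 1 / 2) ^+ 3 / (3 * (c.+1 + c')%:R ^+ 2))%:E <= I (1 / 2)%R 1%R)%E.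
  apply: I3 => //; first lra.
  move=> p x pG xst; have [p4|p4] := leP (1 / 2) p.
    by exists p; rewrite ?pG ?p4.
  by exists (1 / 2); rewrite ?G2 ?lexx//; nra.
apply: le_trans (leeD (leeD I1 I2) I3).
(* The constants come from [(1/4)^3 / 3 = 1/192] and [(1/2)^3 / 3 = 8/192]. *)
rewrite -!EFinD lee_fin le_eqVlt /err; apply/orP; left; apply/eqP.
have -> : (a + a' + 1 = a.+1 + a')%N by lia.
have -> : (c + c' + 1 = c.+1 + c')%N by lia.
have -> : (2 * b + 2 = b.+2 + b)%N by lia.
have : (a.+1 + a')%:R != 0 :> R by rewrite pnatr_eq0.
have : (c.+1 + c')%:R != 0 :> R by rewrite pnatr_eq0.
have : (b.+2 + b)%:R != 0 :> R by rewrite pnatr_eq0.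
move: (a.+1 + a')%:R (c.+1 + c')%:R (b.+2 + b)%:R => u v w w0 v0 u0.
by field; rewrite u0 v0 w0.
Qed.

(** * Discrete minimisation of the error by a Lagrange multiplier *)

(* The gains of the three summands are [gain 1 (2 i + 2)], [gain 1 (2 i + 3)] and
   [gain (1 / 4) (i + 1)], and
   [gain 1 (u + 1) < gain 0 u < gain (1 / 4) u < gain (1 / 2) u < gain 1 u]. *)
Definition gain (e u : R) := 4 * u / (u ^+ 2 - e) ^+ 2.

(** A unit step in [u] outweighs any change of [e] within [[0, 1]]. With [A = u^2 - e] and
    [B = v^2 - e'] one has [v A < u B], hence [u v A^2 <= (v A)^2 < (u B)^2], and [u] cancels. *)
Lemma gain_lt (e e' u v : R) :
  0 <= e -> e' <= 1 -> e < u ^+ 2 -> 1 <= u ->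
  u + 1 <= v \/ u = v /\ e' < e -> gain e' v < gain e u.
Proof.
move=> e0 e1 eu u1 uv0; rewrite /gain.
have uv : u <= v by lra.
have A0 : 0 < u ^+ 2 - e by lra.
have AB : v * (u ^+ 2 - e) < u * (v ^+ 2 - e').
  case: uv0 => [?|[<- ?]]; last nra.
  have : u * v * 1 <= u * v * (v - u) by rewrite ler_wpM2l; nra.
  nra.
have B0 : 0 < v ^+ 2 - e' by nra.
rewrite ltr_pdivrMr ?exprn_gt0// mulrAC ltr_pdivlMr ?exprn_gt0//.
move: (u ^+ 2 - e) (v ^+ 2 - e') A0 B0 AB => A B A0 B0 AB.
have : (v * A) ^+ 2 < (u * B) ^+ 2.
  by rewrite ltr_pXn2r// nnegrE; nra.
have : u * v * A ^+ 2 <= (v * A) ^+ 2.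
  have := sqr_ge0 A; rewrite exprMn; nra.
move=> h1 h2; have := le_lt_trans h1 h2.
rewrite exprMn !expr2 -!mulrA ltr_pM2l; last lra.
by lra.
Qed.

(** Telescoping the decrements makes [m] the only minimiser of [f i + lam * i]. *)
Lemma unimodal_lt (f : nat -> R) (lam : R) (m : nat) :
  (forall i, (m <= i)%N -> f i - f i.+1 < lam) ->
  (forall i, (i < m)%N -> lam < f i - f i.+1) ->
  forall i, i != m -> f m + lam * (m%:R - i%:R) < f i.
Proof.
move=> right left i; rewrite neq_ltn => /orP[im|mi].
- rewrite -(subnKC (ltnW im)).
  have : (0 < m - i)%N by rewrite subn_gt0.
  (* The induction starts at [j = 1], because the strict inequality fails at [j = 0]. *)
  have : forall j, (i + j <= m)%N -> (0 < j)%N ->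
     f (i + j)%N + lam * ((i + j)%:R - i%:R) < f i.
    elim=> // -[_|j IH] ijm _.
      rewrite addn1 in ijm *; have := left i ijm; rewrite -natr1; lra.
    have lt_m : (i + j.+1 < m)%N by rewrite -addnS.
    have := left _ lt_m; have := IH (ltnW lt_m) isT.
    rewrite (addnS i j.+1) -[(i + j.+1).+1%:R]natr1; lra.
  by apply; rewrite subnKC// ltnW.
- have : forall j, f m + lam * (m%:R - (m + j.+1)%:R) < f (m + j.+1)%N.
    elim=> [|j IH].
      have := right m (leqnn m); rewrite addn1 -natr1; lra.
    have := right (m + j.+1)%N (leq_addr _ _).
    rewrite (addnS m j.+1) -[(m + j.+1).+1%:R]natr1; lra.
  move=> /(_ (i - m.+1)%N).
  by rewrite -addSnnS subnKC.
Qed.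

(* [u] and [full] give the position in the chain of gains after [a0 + b0 + c0]
   points; [gain e u] with [e = 0] or [e = 1/2] lies strictly between the last
   gain taken and the next one, and serves as a Lagrange multiplier. *)
Lemma err_argmin (u : nat) (full : bool) (a b c : nat) :
  let a0 := u./2 in let b0 := u.-1./2 in let c0 := (u.-1 + full)%N in
  (0 < u)%N -> (a + b + c <= a0 + b0 + c0)%N ->
  err R (2 * a + 1) (2 * b + 2) (2 * c + 1) <=
  err R (2 * a0 + 1) (2 * b0 + 2) (2 * c0 + 1) ->
  [/\ a = a0, b = b0 & c = c0].
Proof.
move=> a0 b0 c0 u0 abc.
pose e : R := if full then 0 else 1 / 2.
pose lam := gain e u%:R.
have u1 : 1 <= u%:R :> R by rewrite ler1n.
have lam0 : 0 < lam.
  rewrite /lam /gain divr_gt0//; first lra.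
  by rewrite exprn_gt0// /e; case: ifP => _; nra.
pose f1 i : R := 1 / (2 * i + 1)%:R ^+ 2.
pose f2 i : R := 1 / (2 * i + 2)%:R ^+ 2.
pose f3 i : R := 8 / (2 * i + 1)%:R ^+ 2.
have d1 i : f1 i - f1 i.+1 = gain 1 (2 * i + 2)%:R.
  have i0 : 0 <= i%:R :> R by [].
  rewrite /f1 /gain mulnS !natrD; field.
  by rewrite !lt0r_neq0//; nra.
have d2 i : f2 i - f2 i.+1 = gain 1 (2 * i + 3)%:R.
  have i0 : 0 <= i%:R :> R by [].
  rewrite /f2 /gain mulnS !natrD; field.
  by rewrite !lt0r_neq0//; nra.
have d3 i : f3 i - f3 i.+1 = gain (1 / 4) i.+1%:R.
  have i0 : 0 <= i%:R :> R by [].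
  rewrite /f3 /gain mulnS -natr1 !natrD; field.
  by rewrite !lt0r_neq0//; nra.
have e0 : 0 <= e < 1 by rewrite /e; case: ifP => _; lra.
have gt1 (v : nat) : (1 < v)%N -> 1 < v%:R ^+ 2 :> R.
  by move=> v1; rewrite expr_gt1// ltr1n.
have [e_ge0 /ltW e_le1] := andP e0.
have eu : e < u%:R ^+ 2 by nra.
have step (v w : nat) : (v < w)%N -> v%:R + 1 <= w%:R :> R.
  by move=> vw; rewrite natr1 ler_nat.
have F1 : forall i, i != a0 -> f1 a0 + lam * (a0%:R - i%:R) < f1 i.
  apply: unimodal_lt => i ia; rewrite d1;
    apply: gain_lt; rewrite ?ler1n ?addn_gt0 ?orbT//.
  - by left; apply: step; lia.
  - by apply: gt1; lia.
  - have [|] := ltnP (2 * i + 2) u; first by left; apply: step.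
    by right; split; [congr (_%:R); lia|lra].
have F2 : forall i, i != b0 -> f2 b0 + lam * (b0%:R - i%:R) < f2 i.
  apply: unimodal_lt => i ib; rewrite d2;
    apply: gain_lt; rewrite ?ler1n ?addn_gt0 ?orbT//.
  - by left; apply: step; lia.
  - by apply: gt1; lia.
  - have [|] := ltnP (2 * i + 3) u; first by left; apply: step.
    by right; split; [congr (_%:R); lia|lra].
have c0e : (c0 = u /\ e = 0) \/ (c0 = u.-1 /\ e = 1 / 2).
  by rewrite /c0 /e; case: (boolP full) => _; [left|right]; split => //; lia.
have F3 : forall i, i != c0 -> f3 c0 + lam * (c0%:R - i%:R) < f3 i.
  apply: unimodal_lt => i ic; rewrite d3; apply: gain_lt; rewrite ?ler1n//.
  - lra.
  - have [iu|ui] := eqVneq u i.+1; last by left; apply: step; lia.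
    by right; split; [rewrite iu|case: c0e => -[cE ->]; [lia|lra]].
  - by have : 1 <= i.+1%:R :> R; [rewrite ler1n|nra].
  - have [iu|ui] := eqVneq i.+1 u; last by left; apply: step; lia.
    by right; split; [rewrite iu|case: c0e => -[cE ->]; [lra|lia]].
have le (f : nat -> R) m : (forall i, i != m -> f m + lam * (m%:R - i%:R) < f i) ->
    forall i, f m + lam * (m%:R - i%:R) <= f i.
  move=> F i; have [->|/F/ltW//] := eqVneq i m; lra.
(* The budget on the number of points makes the multiplier terms sum to a nonnegative quantity. If a
   coordinate differed, its strict inequality and the two weak ones would contradict the assumed
   comparison of errors. *)
have E : 0 <= lam * (a0%:R - a%:R + (b0%:R - b%:R) + (c0%:R - c%:R)).
  rewrite mulr_ge0 ?(ltW lam0)//.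
  have : (a + b + c)%:R <= (a0 + b0 + c0)%:R :> R by rewrite ler_nat.
  rewrite !natrD; lra.
have := le _ _ F1 a; have := le _ _ F2 b; have := le _ _ F3 c.
rewrite /err -/(f1 a) -/(f2 b) -/(f3 c) -/(f1 a0) -/(f2 b0) -/(f3 c0).
move=> L3 L2 L1 L.
by split; apply/eqP/negPn/negP; [move=> /F1|move=> /F2|move=> /F3]; lra.
Qed.

(** Optimality places the lower bound for [G] below the error of the best grid. Raising [a'] to [a]
    and [c'] to [c] only lowers that bound, so [err_argmin] identifies [a], [b], [c]; equality then
    gives [a' = a] and [c' = c]. *)
Lemma cond_optimal_counts (u n : nat) (full : bool) (G : {fset R}) :
  let a0 := u./2 in let b0 := u.-1./2 in let c0 := (u.-1 + full)%N in
  (0 < u)%N -> n = (a0 + b0 + c0 + 2)%N ->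
  cond_optimal n [fset (1 / 4 : R); (1 / 2 : R)]%fset G ->
  [/\ count_in G 0 (1 / 4) = a0.+1, count_in G (1 / 4) (1 / 2) = b0.+2
    & count_in G (1 / 2) 1 = c0.+1].
Proof.
move=> a0 b0 c0 u0 nE [_ [alpha [alphan GE]] Gmin _].
have lt04 : 0 < 1 / 4 :> R by lra.
have lt42 : 1 / 4 < 1 / 2 :> R by lra.
have lt21 : 1 / 2 < 1 :> R by lra.
have G4 : 1 / 4 \in G by rewrite GE !inE eqxx orbT.
have G2 : 1 / 2 \in G by rewrite GE !inE eqxx !orbT.
have beta2 : #|` [fset (1 / 4 : R); (1 / 2 : R)]%fset| = 2%N.
  by rewrite cardfs2 lt_eqF.
rewrite beta2 in alphan Gmin.
pose a := count (fun p : R => (p < 1 / 4)%R) G.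
pose a' := count (fun p : R => (0 < p < 1 / 4)%R) G.
pose b := count (fun p : R => (1 / 4 < p < 1 / 2)%R) G.
pose c := count (fun p : R => (1 / 2 < p)%R) G.
pose c' := count (fun p : R => (1 / 2 < p < 1)%R) G.
(* Cutting [G] into the parts up to [1/4], strictly between, and from [1/2] on gives [a + 1], [b]
   and [c + 1] points. *)
have abc : (a + b + c <= a0 + b0 + c0)%N.
  have : (size G <= n)%N.
    rewrite GE (leq_trans (leq_card_fsetU _ _).1)// beta2; lia.
  rewrite -(count_predC (fun p : R => p <= 1 / 4)) count_le_lt// -/a.
  rewrite (@count_disjoint _ _ (fun p : R => 1 / 4 < p < 1 / 2) (fun p => 1 / 2 <= p)).
  - by rewrite -/b count_ge_gt// -/c nE; lia.
  - move=> p /=; rewrite -ltNge; case: (ltP p (1 / 2)) => [|/(lt_le_trans lt42) ->].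
      by rewrite andbT orbF.
    by rewrite orbT.
  - by move=> p /=; case: (ltP p (1 / 2)); rewrite ?andbF.
have [beta' [beta'n beta'D]] := distortion_grid R a0 b0 c0.
have beta'N : (#|` beta'| <= n - 2)%N by rewrite nE addnK.
have := distortion_ge G4 G2 (erefl a) (erefl a') (erefl b) (erefl c) (erefl c').
move=> /le_trans/(_ (Gmin _ beta'N))/le_trans/(_ beta'D).
rewrite lee_fin ler_pM2l; last lra.
have a'a : (a' <= a)%N by apply: sub_count => p /= /andP[].
have c'c : (c' <= c)%N by apply: sub_count => p /= /andP[].
(* The equality case recorded here later recovers [a'] and [c']. *)
have inv2 (k : R) (i j : nat) : 0 < k -> (0 < i)%N -> (i <= j)%N ->
    k / j%:R ^+ 2 <= k / i%:R ^+ 2 ?= iff (i == j).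
  move=> k0 i0 ij; split.
    rewrite ler_pM2l// lef_pV2 ?posrE ?exprn_gt0 ?ltr0n//; last exact: leq_trans ij.
    by rewrite ler_pXn2r ?nnegrE// ler_nat.
  apply/eqP/eqP => [|->//] /(mulfI (lt0r_neq0 k0))/invr_inj/eqP.
  by rewrite eqrXn2// eqr_nat => /eqP.
have half (i j : nat) : (i <= j)%N -> (0 < j + i + 1)%N /\ (j + i + 1 <= 2 * j + 1)%N.
  by move=> ij; rewrite !addn1; split; rewrite // mul2n -addnn ltnS leq_add2l.
have [aj0 /(inv2 1 _ _ ltr01 aj0)[aj1 aj2]] := half _ _ a'a.
have [cj0 /(inv2 8 _ _ (ltr0Sn R 7) cj0)[cj1 cj2]] := half _ _ c'c.
rewrite /err => opt.
have [aE bE cE] : [/\ a = a0, b = b0 & c = c0].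
  by apply: (err_argmin (full := full)) => //; rewrite /err; lra.
rewrite aE bE cE in aj1 aj2 cj1 cj2 opt.
have /eqP a'E : (a0 + a' + 1 == 2 * a0 + 1)%N by rewrite -aj2; apply/eqP; lra.
have /eqP c'E : (c0 + c' + 1 == 2 * c0 + 1)%N by rewrite -cj2; apply/eqP; lra.
(* The outer closed counts are squeezed, for instance between [c' + 1] and [c + 1], which now
   agree. *)
rewrite !count_inE; split; last 1 first.
- apply/eqP; rewrite eqn_leq -{1}cE -count_ge_gt//; apply/andP; split.
    by apply: sub_count => p /= /andP[].
  have <- : c' = c0 by move: c'E; rewrite mul2n -addnn => /addIn/addnI.
  by rewrite -count_itvco//; apply: sub_count => p /= /andP[-> /ltW ->].
- apply/eqP; rewrite eqn_leq -{1}aE -count_le_lt//; apply/andP; split.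
    by apply: sub_count => p /= /andP[].
  have <- : a' = a0 by move: a'E; rewrite mul2n -addnn => /addIn/addnI.
  by rewrite -count_itvoc//; apply: sub_count => p /= /andP[/ltW -> ->].
- by rewrite count_itvcc// -bE.
Qed.
End optimality.

Local Open Scope fset_scope.

Theorem theorem3p8 (R : realType) (n : nat) (alphan : {fset R}) :
  (6 <= n)%N ->
  cond_optimal n [fset (1 / 4 : R); (1 / 2 : R)] alphan ->
  let k := count_in alphan 0 (1 / 4) in
  let l := count_in alphan (1 / 4) (1 / 2) in
  let m := count_in alphan (1 / 2) 1 in
  forall x : nat,
    [/\ n = (4 * x + 2)%N -> (k, l, m) = (x + 1, x + 2, 2 * x + 1)%N,
        n = (4 * x + 3)%N -> (k, l, m) = (x + 1, x + 2, 2 * x + 2)%N,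
        n = (4 * x + 4)%N -> (k, l, m) = (x + 2, x + 2, 2 * x + 2)%N &
        n = (4 * x + 5)%N -> (k, l, m) = (x + 2, x + 2, 2 * x + 3)%N].
Proof.
move=> n6 opt k l m x.
(* Each [u] covers two consecutive values of [n], the second ([full]) having one more point in
   [[1/2, 1]]. Passing to the next [u] adds a point to [[0, 1/4]] if the new [u] is even and to
   [[1/4, 1/2]] if it is odd. *)
have H u full E0 E := @cond_optimal_counts R u n full alphan E0 E opt.
split=> nE; rewrite /k /l /m.
- have [||-> -> ->] := H (2 * x + 1)%N false; [lia|lia|].
  by congr (_, _, _); lia.
- have [||-> -> ->] := H (2 * x + 1)%N true; [lia|lia|].
  by congr (_, _, _); lia.
- have [||-> -> ->] := H (2 * x + 2)%N false; [lia|lia|].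
  by congr (_, _, _); lia.
- have [||-> -> ->] := H (2 * x + 2)%N true; [lia|lia|].
  by congr (_, _, _); lia.
Qed.
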